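(* Consider the optimistic rollup game with search costs between the aggregator $A$ and the validator $V$ (described in the context), both players being rational and risk neutral. There exist values of $s_A$, $s_V$, $z$ and $x$ for which this game admits a mixed-strategy Nash equilibrium, i.e. for which there are $b,g,h\in[0,1]$ with $$U_V(b,g,h)\ge U_V(b',g',h)\ \text{ for all } b',g'\in[0,1],\qquad U_A(b,g,h)\ge U_A(b,g,h')\ \text{ for all } h'\in[0,1],$$ that is not the same as the pure-strategy equilibrium of the perfect-information game, in which $A$ behaves honestly with probability $1$ and $V$ (who always knows whether $A$ is honest, i.e. $b=0$) poses no challenge.
   Context: Optimistic rollup game with search costs. Parameters: aggregator stake $s_A>0$, validator stake $s_V>0$, search cost $x>0$, benefit $z>0$ of an undetected dishonest commitment, subject to the standing ordinal constraint $x<s_V\le s_A<z$ ($z$ is thought of as much larger than $s_A$). The payoff of honest behavior for $A$ is normalized to $0$. First $V$ chooses No Search or Search (at cost $x$). Then $A$, not observing this choice, chooses Honest or Dishonest. Then $V$ chooses Challenge or No (no challenge). After No Search, $V$ does not know whether $A$ was honest; after Search, $V$ knows. Payoffs $(A,V)$: After No Search: (Honest, Challenge): $(0,-s_V)$; (Honest, No): $(0,0)$; (Dishonest, Challenge): $(-s_A,\frac12 s_A)$; (Dishonest, No): $(z,0)$. After Search: the same payoffs with $x$ subtracted from $V$'s payoff. After Search, $V$ challenges if and only if $A$ is dishonest. Mixed strategies: $V$ chooses No Search with probability $b$ and, after No Search, challenges with probability $g$; $A$ is honest with probability $h$. The expected utilities are $$U_A(b,g,h)=(1-h)\bigl(b\,(g(-s_A)+(1-g)z)+(1-b)(-s_A)\bigr),$$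 $$U_V(b,g,h)=bg\bigl(h(-s_V)+(1-h)\tfrac12 s_A\bigr)+(1-b)\bigl((1-h)\tfrac12 s_A-x\bigr).$$ Perfect-information game: the version in which $V$ observes $A$'s choice for free; its pure equilibrium has $A$ honest and $V$ not challenging. *)

(* Defs.v *)
From Stdlib Require Import Reals.
Open Scope R_scope.

Definition in01 (p : R) : Prop := 0 <= p <= 1.

Definition admissible (sA sV z x : R) : Prop :=
  0 < x /\ x < sV /\ sV <= sA /\ sA < z.

(* Mixed strategies: [b] is the probability that the validator does not search,
   [g] the probability that it challenges after not searching, [h] the
   probability that the aggregator is honest.  After searching, the validator
   challenges exactly when the aggregator is dishonest; the terms with factor
   [1 - b] are the payoffs under that rule. *)
Definition UA (sA z b g h : R) : R :=
  (1 - h) * (b * (g * (- sA) + (1 - g) * z) + (1 - b) * (- sA)).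

Definition UV (sA sV x b g h : R) : R :=
  b * g * (h * (- sV) + (1 - h) * (1 / 2 * sA))
  + (1 - b) * ((1 - h) * (1 / 2 * sA) - x).

(* The aggregator does not observe whether the validator searches, so a
   validator deviation changes [b] and [g] jointly against a fixed [h]. *)
Definition nash_equilibrium (sA sV z x b g h : R) : Prop :=
  in01 b /\ in01 g /\ in01 h /\
  (forall b' g' : R, in01 b' -> in01 g' ->
     UV sA sV x b g h >= UV sA sV x b' g' h) /\
  (forall h' : R, in01 h' -> UA sA z b g h >= UA sA z b g h').

(* Total probability that a challenge is made: with probability [g] after not
   searching, and exactly against a dishonest aggregator after searching. *)
Definition challenge_prob (b g h : R) : R := b * g + (1 - b) * (1 - h).

(* The pure equilibrium of the game in which the validator observes the
   aggregator's choice for free, read as a profile of the search game: the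
   validator always knows the choice ([b = 0]), the aggregator is honest, and
   no challenge occurs.  Since [g] is off the path of play when [b = 0], its
   value is left free. *)
Definition perfect_information_equilibrium (b g h : R) : Prop :=
  h = 1 /\ b = 0 /\ challenge_prob b g h = 0.

(* Main.v *)
Require Import Defs.
From Stdlib Require Import Reals Lra.
Open Scope R_scope.

(* Take [g = 0].  Then [b = sA / (sA + z)] makes the aggregator indifferent
   between honesty and dishonesty, and [1 - h = 2 x / sA] makes the validator
   indifferent between searching and not searching; challenging without having
   searched is a loss as soon as [x <= h * sV]. *)

Theorem theorem2 :
  exists sA sV z x : R,
    admissible sA sV z x /\
    exists b g h : R,
      nash_equilibrium sA sV z x b g h /\
      ~ perfect_information_equilibrium b g h.
Proof.
  exists 2, 2, 6, (1/2); split.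
  { unfold admissible; lra. }
  (* The indifference formulas at these parameters: [b = 2 / (2 + 6)] and
     [1 - h = 2 * (1/2) / 2]. *)
  exists (1/4), 0, (1/2); split.
  - unfold nash_equilibrium, in01, UA, UV.
    repeat split; try lra.
    + intros b' g' Hb Hg.
      (* At [h = 1/2] the search term vanishes, so a deviation pays [- (b' * g') / 2] against [0].
         With the sign of this product known, the goal is linear in it. *)
      assert (0 <= b' * g') by (apply Rmult_le_pos; lra).
      lra.
    (* The factor of [1 - h'] is [6/4 - 2 * (3/4) = 0], so every [h'] pays [0]. *)
    + intros h' _; lra.
  (* Already [h = 1/2] differs from [1]. *)
  - unfold perfect_information_equilibrium; lra.
Qed.
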